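(* Let $a\in(0,\frac12]$ and let $\alpha=\{\alpha_1,\alpha_2\}$ be a set of weight functions on $[0,1]$. Let $\lambda_S$ be the measure obtained from Lebesgue measure $\lambda$ on $[0,1]$ by the equipped $2$-transformation $\{S,\alpha\}$, $S=S(a)=S_1\cup S_2$. Then $\lambda_S=\lambda$ if and only if there is an integer $n\ge 2$ such that $a=\frac1n$ and, for $\lambda$-almost every $x$ in the indicated intervals, $$\alpha_1(x)=\frac{n-k}{n-1},\qquad x\in\left[\frac{k-1}{n},\frac{k}{n}\right),\quad k=2,3,\ldots,n-1$$ (that is, $\alpha_1=\frac{n-2}{n-1}$ on $[\frac1n,\frac2n)$, $\alpha_1=\frac{n-3}{n-1}$ on $[\frac2n,\frac3n)$, ..., $\alpha_1=\frac1{n-1}$ on $[\frac{n-2}{n},\frac{n-1}{n})$), with $\alpha_1$ arbitrary on the intervals $[0,\frac1n)$ and $[\frac{n-1}{n},1]$.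
   Context: $\lambda$ is Lebesgue measure on $[0,1]$ and $\mathfrak B$ is the $\sigma$-field of Borel subsets of $[0,1]$. For $a\in(0,\frac12]$ define $S_1,S_2:[0,1]\to[0,1]$ by $$S_1(x)=\begin{cases}\frac{x}{1-a},&x\in[0,1-a),\\ \frac{x-a}{1-a},&x\in[1-a,1],\end{cases}\qquad S_2(x)=\begin{cases}\frac{x}{1-a},&x\in[0,a),\\ \frac{x-a}{1-a},&x\in[a,1].\end{cases}$$ The $2$-valued transformation is $S=S(a)=S_1\cup S_2$. A set of weight functions is a pair $\alpha=\{\alpha_1,\alpha_2\}$ with $\alpha_1,\alpha_2\in L^1([0,1],\mathfrak B,\lambda)$, $\alpha_1,\alpha_2\ge 0$ and $\alpha_1(x)+\alpha_2(x)\equiv 1$. The measure $\lambda_S$ is defined for $B\in\mathfrak B$ by $$\lambda_S(B)=\int_{S_1^{-1}(B)}\alpha_1(x)\,d\lambda+\int_{S_2^{-1}(B)}\alpha_2(x)\,d\lambda.$$ ''Arbitrary'' means subject only to the requirements on weight functions. *)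

(* Defs.v *)
From HB Require Import structures.
From mathcomp Require Import all_boot all_order all_algebra.
From mathcomp Require Import all_classical all_reals all_analysis.

Set Implicit Arguments.
Unset Strict Implicit.
Unset Printing Implicit Defensive.

Import Order.TTheory GRing.Theory Num.Theory.
Import numFieldNormedType.Exports.

Local Open Scope classical_set_scope.
Local Open Scope ring_scope.

(* The space [0, 1] is the set `[0, 1] of R: its Borel sets are the Borel sets
   of R included in `[0, 1], and Lebesgue measure on it is the restriction of
   [lebesgue_measure] to these. Functions on [0, 1] are functions on R of which
   only the values on `[0, 1] matter. *)

Definition S1 (R : realType) (a x : R) : R :=
  if x < 1 - a then x / (1 - a) else (x - a) / (1 - a).

Definition S2 (R : realType) (a x : R) : R :=
  if x < a then x / (1 - a) else (x - a) / (1 - a).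

Definition weight_functions (R : realType) (alpha1 alpha2 : R -> R) : Prop :=
  [/\ (@lebesgue_measure R).-integrable `[0, 1] (EFin \o alpha1),
      (@lebesgue_measure R).-integrable `[0, 1] (EFin \o alpha2),
      forall x, x \in `[0, 1] -> 0 <= alpha1 x /\ 0 <= alpha2 x &
      forall x, x \in `[0, 1] -> alpha1 x + alpha2 x = 1].

Definition lambda_S (R : realType) (a : R) (alpha1 alpha2 : R -> R)
    (B : set R) : \bar R :=
  (\int[@lebesgue_measure R]_(x in `[0%R, 1%R] `&` S1 a @^-1` B)
      (alpha1 x)%:E
   + \int[@lebesgue_measure R]_(x in `[0%R, 1%R] `&` S2 a @^-1` B)
      (alpha2 x)%:E)%E.

(* Main.v *)
Require Import Defs.
From HB Require Import structures.
From mathcomp Require Import all_boot all_order all_algebra.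
From mathcomp Require Import all_classical all_reals all_analysis.
From mathcomp Require Import measurable_realfun ring lra.

Set Implicit Arguments.
Unset Strict Implicit.
Unset Printing Implicit Defensive.

Import Order.TTheory GRing.Theory Num.Theory.
Import numFieldNormedType.Exports.

Local Open Scope classical_set_scope.
Local Open Scope ring_scope.

(* Let beta be the weight of the branch x |-> x / (1 - a), so that 1 - beta is
   that of x |-> (x - a) / (1 - a); beta is 1 on [0, a), alpha1 on [a, 1 - a)
   and 0 on [1 - a, 1]. Translating the second branch by a gives
     lambda_S B = \int_((1 - a) B) (1 + beta x - beta (x + a)) dx,
   so lambda_S = lambda iff beta x - beta (x + a) = a / (1 - a) for almost every
   x in [0, 1 - a). For almost every x this holds along the whole orbit of x
   under translation by a: beta decreases from 1 on [0, a) by steps a / (1 - a)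
   until it is 0 on [1 - a, 1). Hence (1 - a) / a is an integer j,
   that is a = 1 / (j + 1), and beta = 1 - i / j on [i a, (i + 1) a). *)

(** * Lebesgue measure under affine maps and translations *)

Lemma lebesgue_measure_affine (R : realType) (c b : R) (A : set R) :
  0 < c -> measurable A ->
  (c%:E * lebesgue_measure ((fun x => (c * x + b)%R) @^-1` A)
     = lebesgue_measure A)%E.
Proof.
move=> c0 mA; pose phi (x : measurableTypeR R) : measurableTypeR R := c * x + b.
have mphi : measurable_fun setT phi.
  by apply: measurable_funD => //; exact: measurable_funM.
(* [nu] is the left-hand side as a measure in [A]; by uniqueness of Lebesgue measure, only the
   intervals []p, q]] have to be compared. *)
pose nu := mscale (NngNum (ltW c0)) (pushforward (@lebesgue_measure R) phi).
rewrite -[LHS]/(nu mphi A); apply/esym.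
apply: lebesgue_measure_unique => // _ [[p q] _ <-].
rewrite -[RHS]/(c%:E * lebesgue_measure (phi @^-1` `]p, q]))%E.
rewrite (_ : _ @^-1` _ = `](p - b) / c, (q - b) / c]%classic); last first.
  apply/seteqP; split=> x; rewrite /= !in_itv/= /phi;
  rewrite ltr_pdivrMr// ler_pdivlMr// => /andP[px xq]; apply/andP; split; lra.
rewrite !lebesgue_measure_itv/= !lte_fin ltr_pM2r ?invr_gt0// ltrD2r.
case: ifP => _; last by rewrite mule0.
by rewrite -!EFinB -EFinM; congr EFin; field; exact: lt0r_neq0.
Qed.

Section preimage_translation.
Variables (R : realType) (b : R).
Local Notation mu := (@lebesgue_measure R).

Lemma lebesgue_measure_translation (A : set R) : measurable A ->
  mu ((fun x => x + b) @^-1` A) = mu A.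
Proof.
move=> mA; rewrite -[RHS](@lebesgue_measure_affine R 1 b)// mul1e.
by congr (mu _); apply/seteqP; split=> x /=; rewrite mul1r.
Qed.

Lemma measurable_translation : measurable_fun setT (fun x : R => x + b).
Proof. exact: measurable_funD. Qed.

Lemma ge0_integral_translation (A : set R) (f : R -> \bar R) :
  measurable A -> measurable_fun A f -> {in A, forall x, (0 <= f x)%E} ->
  (\int[mu]_(x in (fun x => x + b)%R @^-1` A) f (x + b)%R
     = \int[mu]_(x in A) f x)%E.
Proof.
move=> mA mf f0.
have mphi : measurable_fun setT
    ((fun x => x + b) : measurableTypeR R -> measurableTypeR R).
  exact: measurable_translation.
have /= <- := ge0_integral_pushforward mphi mu mA mf f0.
by apply: eq_measure_integral => B mB _; exact: lebesgue_measure_translation.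
Qed.

(** Null sets stay null under translation. This is what lets an almost everywhere condition be
    imposed along a whole orbit. *)
Lemma ae_translation (P : R -> Prop) :
  {ae mu, forall x, P x} -> {ae mu, forall x, P (x + b)}.
Proof.
move=> [N [mN N0 PN]]; exists ((fun x => x + b) @^-1` N); split.
- by rewrite -[X in measurable X]setTI; exact: measurable_translation.
- by rewrite lebesgue_measure_translation.
- by move=> x /= Px; exact: PN.
Qed.

End preimage_translation.

(* The weight of the branch x |-> x / (1 - a): where S1 and S2 agree it is 0 or
   1, whatever the alphas are. The branch x |-> (x - a) / (1 - a) has the
   complementary weight. *)
Definition left_weight (R : realType) (a : R) (alpha1 : R -> R) (x : R) : R :=
  if x < a then 1 else if x < 1 - a then alpha1 x else 0.

(** * The density of [lambda_S] *)

Section density.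
Variables (R : realType) (a : R) (alpha1 alpha2 : R -> R).
Local Notation mu := (@lebesgue_measure R).
Local Notation beta := (left_weight a alpha1).

(** Valid on the whole line: off [[a, 1 - a)] the value is 0 or 1, and that interval lies in
    [[0, 1]], where the alphas are nonnegative with sum 1. *)
Lemma left_weight_itv (a_gt0 : 0 < a) (a_le : a <= 1 / 2)
    (alphaP : weight_functions alpha1 alpha2) x : 0 <= beta x <= 1.
Proof.
case: alphaP => _ _ ge0 sum1; rewrite /left_weight.
case: ltP => xa; first by lra.
case: ltP => xa1; last by lra.
have x0 : 0 <= x by lra.
have x1 : x <= 1 by lra.
have x01 : x \in `[0, 1] by rewrite in_itv/= x0 x1.
have [alpha1_ge0 alpha2_ge0] := ge0 x x01; have := sum1 x x01.
by move=> ?; apply/andP; split; lra.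
Qed.

Lemma measurable_left_weight (a_gt0 : 0 < a)
    (alphaP : weight_functions alpha1 alpha2) : measurable_fun setT beta.
Proof.
case: alphaP => /measurable_int/measurable_EFinP malpha1 _ _ _.
apply: measurable_fun_if => //; first exact: measurable_fun_ltr.
apply: measurable_fun_if => //.
- rewrite setTI (_ : _ @^-1` _ = `[a, +oo[%classic)//.
  apply/seteqP; split=> x; rewrite /= in_itv/= andbT.
    by move=> /negbT; rewrite -leNgt.
  by rewrite leNgt => /negbTE.
- exact: measurable_fun_ltr.
(* [alpha1] is known to be measurable on [[0, 1]] only, which contains the region where [beta]
   consults it. *)
- apply: measurable_funS malpha1 => // x /= [[_ /negbT]].
  rewrite -leNgt => xa xa1.
  have x0 : 0 <= x := le_trans (ltW a_gt0) xa.
  have x1 : x <= 1 by lra.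
  by rewrite in_itv/= x0 x1.
Qed.

Lemma measurable_S1 : measurable_fun setT (S1 a).
Proof.
apply: measurable_fun_ifT; first exact: measurable_fun_ltr.
  exact: measurable_funM.
by apply: measurable_funM => //; exact: measurable_funB.
Qed.

Lemma measurable_S2 : measurable_fun setT (S2 a).
Proof.
apply: measurable_fun_ifT; first exact: measurable_fun_ltr.
  exact: measurable_funM.
by apply: measurable_funM => //; exact: measurable_funB.
Qed.

(** Regroup by affine formula instead of by map: [S1] and [S2] both take the left formula below [a]
    and both the right one from [1 - a] on; in between, [S1] goes left and [S2] right. *)
Lemma lambda_S_branches (a_gt0 : 0 < a) (a_le : a <= 1 / 2)
    (alphaP : weight_functions alpha1 alpha2) B : measurable B ->
  lambda_S a alpha1 alpha2 B =
    (\int[mu]_(x in `[0%R, 1%R])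
       (beta x * \1_B (x / (1 - a))
          + (1 - beta x) * \1_B ((x - a) / (1 - a)))%:E)%E.
Proof.
move=> mB; case: alphaP => /measurable_int/measurable_EFinP m1
  /measurable_int/measurable_EFinP m2 ge0 sum1.
have mB1 : measurable_fun (`[0, 1]%classic : set R)
    (fun x => \1_B (S1 a x) : R).
  apply: (measurableT_comp (f := \1_B : R -> R)); first exact: measurable_indic.
  exact: measurable_funTS measurable_S1.
have mB2 : measurable_fun (`[0, 1]%classic : set R)
    (fun x => \1_B (S2 a x) : R).
  apply: (measurableT_comp (f := \1_B : R -> R)); first exact: measurable_indic.
  exact: measurable_funTS measurable_S2.
rewrite /lambda_S !integral_mkcondr !epatch_indic -ge0_integralD//=.
- apply: eq_integral => x; rewrite inE/= => x01.
  rewrite /= -!EFinM -EFinD; congr EFin.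
  have -> : \1_(S1 a @^-1` B) x = \1_B (S1 a x) :> R by [].
  have -> : \1_(S2 a @^-1` B) x = \1_B (S2 a x) :> R by [].
  have -> : alpha2 x = 1 - alpha1 x by rewrite -(sum1 x x01) addrC addKr.
  rewrite /S1 /S2 /left_weight.
  (* The case [x < a], [1 - a <= x] is excluded by [a <= 1 / 2]. *)
  by case: (ltP x a) => xa; case: (ltP x (1 - a)) => xa1; solve [ring|lra].
- move=> x x01; rewrite -EFinM lee_fin mulr_ge0 ?indic_ge0//.
  by have [] := ge0 x x01.
- by apply/measurable_EFinP; exact: measurable_funM m1 mB1.
- move=> x x01; rewrite -EFinM lee_fin mulr_ge0 ?indic_ge0//.
  by have [] := ge0 x x01.
- by apply/measurable_EFinP; exact: measurable_funM m2 mB2.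
Qed.

Lemma lambda_S_density (a_gt0 : 0 < a) (a_le : a <= 1 / 2)
    (alphaP : weight_functions alpha1 alpha2) (B : set R) :
  measurable B -> B `<=` `[0, 1] ->
  lambda_S a alpha1 alpha2 B =
    (\int[mu]_(x in (fun x => x / (1 - a))%R @^-1` B)
       (1 + beta x - beta (x + a))%:E)%E.
Proof.
move=> mB B01; rewrite lambda_S_branches//.
have a1 : 0 < 1 - a by lra.
(* [A] and [A'], the translate of [A] by [a], are the preimages of [B] under the two branches; both
   stay inside [[0, 1]] because [B] does. *)
pose A := (fun x => x / (1 - a)) @^-1` B.
pose A' := (fun x => x - a) @^-1` A.
have mA : measurable A.
  by rewrite -[A]setTI; apply: measurable_funM.
have mA' : measurable A'.
  by rewrite -[A']setTI; exact: measurable_translation.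
have A01 : A `<=` `[0, 1].
  move=> x /B01; rewrite /= !in_itv/= ler_pdivlMr// ler_pdivrMr// => /andP[? ?].
  by apply/andP; split; lra.
have A'01 : A' `<=` `[0, 1].
  move=> x /B01; rewrite /= !in_itv/= ler_pdivlMr// ler_pdivrMr// => /andP[? ?].
  by apply/andP; split; lra.
have mbeta := measurable_left_weight a_gt0 alphaP.
have mbetaC : measurable_fun setT (fun x => 1 - beta x).
  exact: measurable_funB.
have beta0 x : 0 <= beta x.
  by have /andP[] := left_weight_itv a_gt0 a_le alphaP x.
have betaC0 x : 0 <= 1 - beta x.
  by rewrite subr_ge0; have /andP[] := left_weight_itv a_gt0 a_le alphaP x.
transitivity (\int[mu]_(x in `[0%R, 1%R])
  (((EFin \o beta) \_ A) x + ((fun x => (1 - beta x)%:E) \_ A') x))%E.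
  by apply: eq_integral => x _; rewrite !epatch_indic/= -!EFinM -EFinD.
rewrite ge0_integralD//.
- rewrite -!integral_mkcondr !setIidr//.
  rewrite -[X in (_ + X)%E](ge0_integral_translation a)//; first last.
  + by move=> x _; rewrite lee_fin.
  + by apply/measurable_EFinP; exact: measurable_funTS.
  rewrite (_ : _ @^-1` A' = A); last first.
    by apply/seteqP; split=> x; rewrite /A' /= addrK.
  rewrite -ge0_integralD//.
  + by apply: eq_integral => x _; rewrite -EFinD addrA [beta x + 1]addrC.
  + by move=> x _; rewrite lee_fin.
  + by apply/measurable_EFinP; exact: measurable_funTS.
  + by move=> x _; rewrite lee_fin.
  + apply/measurable_EFinP/measurable_funTS.
    exact: (measurableT_comp mbetaC (measurable_translation a)).
- by move=> x _; apply: erestrict_ge0 => y _; rewrite lee_fin.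
- apply/measurable_restrict => //; apply/measurable_EFinP.
  exact: measurable_funTS.
- by move=> x _; apply: erestrict_ge0 => y _; rewrite lee_fin.
- apply/measurable_restrict => //; apply/measurable_EFinP.
  exact: measurable_funTS.
Qed.

End density.

(** * The equation for [beta] along translation by [a], and its orbits *)

Section cocycle.
Variables (R : realType) (a : R) (alpha1 alpha2 : R -> R).
Local Notation mu := (@lebesgue_measure R).
Local Notation beta := (left_weight a alpha1).

(** The measure of [B] is the integral of the constant [1 / (1 - a) = 1 + a / (1 - a)] over the left
    preimage of [B], so the density of [lambda_S] is compared with this constant. *)
Lemma lambda_S_eqP (a_gt0 : 0 < a) (a_le : a <= 1 / 2)
    (alphaP : weight_functions alpha1 alpha2) :
  (forall B : set R, measurable B -> B `<=` `[0, 1] ->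
     lambda_S a alpha1 alpha2 B = mu B) <->
  {ae mu, forall x, 0 <= x < 1 - a -> beta x - beta (x + a) = a / (1 - a)}.
Proof.
have a1 : 0 < 1 - a by lra.
have mbeta := measurable_left_weight a_gt0 alphaP.
have mh : measurable_fun setT (fun x => 1 + beta x - beta (x + a)).
  apply: measurable_funB; first exact: measurable_funD.
  exact: (measurableT_comp mbeta (measurable_translation a)).
have cE : (1 - a)^-1 = 1 + a / (1 - a) by field; exact: lt0r_neq0.
have scaleE B : measurable B ->
    (((1 - a)^-1)%:E * mu ((fun x => x / (1 - a))%R @^-1` B) = mu B)%E.
  move=> mB.
  rewrite -[RHS](@lebesgue_measure_affine R (1 - a)^-1 0) ?invr_gt0//.
  by congr (_ * mu _)%E; apply/seteqP; split=> x /=; rewrite addr0 mulrC.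
split=> [lambda_eq|beta_ae B mB B01].
- pose D : set R := `[0, 1 - a]%classic.
  have mD : measurable D by exact: measurable_itv.
  have Dfin : (mu D < +oo)%E.
    by rewrite lebesgue_measure_itv/=; case: ifP; rewrite -?EFinB ltry.
  have : ae_eq mu D (fun x => (1 + beta x - beta (x + a))%:E)
      (cst ((1 - a)^-1)%:E).
    apply: integral_ae_eq => //.
    + apply: measurable_bounded_integrable => //.
      * exact: measurable_funTS.
      * exists 3; split => // M M3 x _.
        have /andP[? ?] := left_weight_itv a_gt0 a_le alphaP x.
        have /andP[? ?] := left_weight_itv a_gt0 a_le alphaP (x + a).
        by rewrite /= ler_norml; apply/andP; split; lra.
    + move=> E ED mE.
      (* Every measurable [E] in [[0, 1 - a]] is the left preimage of a Borel subset of [[0, 1]], so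
         the two integrands have equal integrals over all such [E]. *)
      pose B := (fun y => (1 - a) * y) @^-1` E.
      have mB : measurable B by rewrite -[B]setTI; exact: measurable_funM.
      have BE : (fun x => x / (1 - a)) @^-1` B = E.
        apply/seteqP; split=> x; rewrite /B /= mulrCA mulfV ?mulr1//;
        exact: lt0r_neq0.
      have B01 : B `<=` `[0, 1].
        move=> y /ED; rewrite /D/= !in_itv/= pmulr_rge0// => /andP[-> /=].
        by rewrite ger_pMr.
      transitivity (lambda_S a alpha1 alpha2 B).
        by rewrite lambda_S_density// BE.
      by rewrite lambda_eq// integral_cst// -BE scaleE.
  apply: filterS => x + /andP[x0 x1].
  have xD : D x by rewrite /D/= in_itv/= x0 ltW.
  move=> /(_ xD)[e]; rewrite cE in e; lra.
- pose A := (fun x => x / (1 - a)) @^-1` B.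
  have mA : measurable A.
    by rewrite -[A]setTI; apply: measurable_funM.
  rewrite lambda_S_density// -[RHS]scaleE// -/A -integral_cst//.
  apply: ae_eq_integral => //.
    by apply/measurable_EFinP; exact: measurable_funTS.
  have ae_filter := ae_filter_ringOfSetsType mu.
  (* The left preimage of 1 is [1 - a], where the equation is not assumed; this single point is
     discarded. *)
  have : {ae mu, forall x, x != 1 - a}.
    exists [set 1 - a]; split => //; first exact: lebesgue_measure_set1.
    by move=> x /= /negP; rewrite negbK => /eqP.
  apply: filterS2 beta_ae => x + xa Ax.
  have := B01 _ Ax.
  rewrite /= in_itv/= ler_pdivlMr// ler_pdivrMr// mul0r mul1r.
  move=> /andP[x0 x1].
  have x1' : x < 1 - a by rewrite lt_neqAle xa x1.
  rewrite x0 x1' => /(_ isT) e; congr EFin; rewrite [RHS]cE; lra.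
Qed.

End cocycle.

(** Induction on the number [j] of translations from [[0, a)], where the weight is 1, up to [y];
    each one lowers the weight by [c]. The bound [y < 1] puts [y - a] below [1 - a], where the step
    is available. *)
Lemma left_weight_orbit (R : realType) (a c : R) (alpha1 : R -> R) (j : nat) y :
  (forall i : nat, 0 <= y - i%:R * a < 1 - a ->
     left_weight a alpha1 (y - i%:R * a)
       - left_weight a alpha1 (y - i%:R * a + a) = c) ->
  0 < a -> 0 <= y - j%:R * a < a -> y < 1 ->
  left_weight a alpha1 y = 1 - j%:R * c.
Proof.
move=> + a0; elim: j y => [|j IH] y step ja y1.
  have ya : y < a by lra.
  by rewrite /left_weight ya mul0r subr0.
have j1 : j.+1%:R = j%:R + 1 :> R by rewrite -natr1.
have ja0 : 0 <= j%:R * a by rewrite mulr_ge0// ltW.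
rewrite j1 in ja *.
have := step 1%N; rewrite mul1r subrK => step1.
have IHy : left_weight a alpha1 (y - a) = 1 - j%:R * c.
  apply: IH; [|lra|lra] => i.
  have -> : y - a - i%:R * a = y - i.+1%:R * a by rewrite -natr1; ring.
  exact: step.
have : left_weight a alpha1 (y - a) - left_weight a alpha1 y = c.
  by apply: step1; lra.
by rewrite IHy; lra.
Qed.

(** An interval of positive length is not contained in a null set. *)
Lemma ae_exists_itv (R : realType) (P : R -> Prop) (p q : R) : p < q ->
  {ae @lebesgue_measure R, forall x, P x} -> exists x, p <= x < q /\ P x.
Proof.
move=> pq [N [mN N0 PN]]; apply: contrapT => nex.
have : (@lebesgue_measure R `[p, q[ <= lebesgue_measure N)%E.
  apply: le_measure; rewrite ?inE//.
  move=> x /=; rewrite in_itv/= => xpq.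
  by apply: PN => Px; apply: nex; exists x.
rewrite N0 lebesgue_measure_itv/= lte_fin pq -EFinB lee_fin.
by lra.
Qed.

(** * Solving the equation: [a = 1 / n] and the values of [alpha1] *)

Theorem theorem2 (R : realType) (a : R) (alpha1 alpha2 : R -> R)
    (a_gt0 : 0 < a) (a_le : a <= 1 / 2)
    (alphaP : weight_functions alpha1 alpha2) :
  (forall B : set R, measurable B -> B `<=` `[0, 1] ->
     lambda_S a alpha1 alpha2 B = lebesgue_measure B) <->
  (exists n : nat, [/\ (2 <= n)%N, a = 1 / n%:R &
     forall k : nat, (2 <= k <= n - 1)%N ->
       {ae @lebesgue_measure R, forall x : R,
         x \in `[(k%:R - 1) / n%:R, k%:R / n%:R[ ->
         alpha1 x = (n%:R - k%:R) / (n%:R - 1)}]).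
Proof.
rewrite lambda_S_eqP//.
have ae_filter := ae_filter_ringOfSetsType (@lebesgue_measure R).
have a1 : 0 < 1 - a by lra.
split=> [step_ae|[n [n2 aE alpha1_ae]]].
- have orbit_ae : {ae @lebesgue_measure R, forall y, forall i : nat,
      0 <= y - i%:R * a < 1 - a ->
      left_weight a alpha1 (y - i%:R * a)
        - left_weight a alpha1 (y - i%:R * a + a) = a / (1 - a)}.
    by apply: ae_foralln => i; exact: (ae_translation (- (i%:R * a)) step_ae).
  (* On [[1 - a, 1)] the weight is 0, so a good point there shows that [j] decrements of
     [a / (1 - a)] add up to exactly 1. *)
  have [y [y_itv y_orbit]] := @ae_exists_itv R _ (1 - a) 1 ltac:(lra) orbit_ae.
  pose j := Num.truncn (y / a).
  have ya0 : 0 <= y / a by rewrite divr_ge0//; lra.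
  have ja : 0 <= y - j%:R * a < a.
    have := truncn_itv ya0; rewrite -/j ler_pdivlMr// ltr_pdivrMr// -natr1.
    by lra.
  have beta0 : left_weight a alpha1 y = 0.
    rewrite /left_weight; case: ltP => ya; first lra.
    by case: ltP => // y1; lra.
  have jc : 1 = j%:R * (a / (1 - a)).
    have := left_weight_orbit y_orbit a_gt0 ja; rewrite beta0.
    by move=> /(_ ltac:(lra)); lra.
  have ja1 : j%:R * a = 1 - a.
    by rewrite -[LHS](divfK (lt0r_neq0 a1)) -(mulrA j%:R) -jc mul1r.
  have j0 : j != 0%N by apply: contraPneq ja1 => ->; lra.
  have nE : j.+1%:R = a^-1 :> R.
    rewrite -natr1; apply: (mulIf (lt0r_neq0 a_gt0)).
    by rewrite mulVf ?lt0r_neq0// mulrDl ja1; lra.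
  have cE : a / (1 - a) = j%:R^-1.
    apply: (mulfI (_ : j%:R != 0)); first by rewrite pnatr_eq0.
    by rewrite -jc mulfV// pnatr_eq0.
  exists j.+1; split.
  + by rewrite ltnS lt0n.
  + by rewrite nE div1r invrK.
  + move=> k /andP[k2 kj].
    rewrite subn1/= in kj.
    apply: filterS orbit_ae => x x_orbit.
    rewrite in_itv/= nE invrK => /andP[kx xk].
    have kE : k.-1%:R = k%:R - 1 :> R by rewrite -subn1 natrB// ltnW.
    (* Since [2 <= k <= j], [x] lies in [[a, 1 - a)], where the weight is [alpha1]; it is [k - 1]
       translations away from [[0, a)]. *)
    have xa : a <= x.
      apply: le_trans kx; rewrite ler_peMl// ?(ltW a_gt0)//.
      have : 2 <= k%:R :> R by rewrite ler_nat.
      by lra.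
    have x1 : x < 1 - a.
      by apply: lt_le_trans xk _; rewrite -ja1 ler_wpM2r ?ler_nat// ltW.
    have := left_weight_orbit (j := k.-1) x_orbit a_gt0.
    rewrite kE => /(_ ltac:(lra) ltac:(lra)).
    rewrite /left_weight ltNge xa/= x1 => ->.
    rewrite cE -nE -natr1; field.
    by rewrite addrK pnatr_eq0.
- pose beta := left_weight a alpha1.
  have n0 : 0 < n%:R :> R by rewrite ltr0n ltnW.
  have n1 : 0 < n%:R - 1 :> R by rewrite subr_gt0 ltr1n.
  have an : a * n%:R = 1 by rewrite aE div1r mulVf// lt0r_neq0.
  have predE : (n - 1)%:R = n%:R - 1 :> R by rewrite natrB// ltnW.
  (* One null set serves all [k]; outside the range the condition is vacuous. *)
  have all_ae : {ae @lebesgue_measure R, forall x (k : nat),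
      (2 <= k <= n - 1)%N -> x \in `[(k%:R - 1) / n%:R, k%:R / n%:R[ ->
      alpha1 x = (n%:R - k%:R) / (n%:R - 1)}.
    apply: ae_foralln => k.
    have [/alpha1_ae|_] := boolP (2 <= k <= n - 1)%N.
      by apply: filterS => x + _.
    exact: filterE.
  (* On [[j / n, (j + 1) / n)], the cases [j = 0] and [j = n - 1] are the end intervals, with
     weights 1 and 0; otherwise the formula for [alpha1] applies with [k = j + 1]. *)
  have betaE x (j : nat) : (forall k : nat,
      (2 <= k <= n - 1)%N -> x \in `[(k%:R - 1) / n%:R, k%:R / n%:R[ ->
      alpha1 x = (n%:R - k%:R) / (n%:R - 1)) -> x < 1 ->
      j%:R <= x * n%:R < j%:R + 1 -> beta x = 1 - j%:R / (n%:R - 1).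
    move=> x_alpha x1 /andP[jx xj].
    have jn : (j <= n - 1)%N.
      have xn : x * n%:R < n%:R by rewrite gtr_pMl.
      by rewrite -ltnS subn1 prednK ?(ltnW n2)// -(ltr_nat R) (le_lt_trans jx).
    rewrite /beta /left_weight.
    have [j0|j0] := eqVneq j 0%N.
      have -> : x < a by rewrite -(ltr_pM2r n0) an; move: xj; rewrite j0 add0r.
      by rewrite j0 mul0r subr0.
    have -> : (x < a) = false.
      apply/negbTE; rewrite -leNgt -(ler_pM2r n0) an (le_trans _ jx)//.
      by rewrite ler1n lt0n.
    have [jn1|nj] := ltnP j (n - 1).
      have -> : x < 1 - a.
        rewrite -(ltr_pM2r n0) mulrBl an mul1r (lt_le_trans xj)//.
        by rewrite -predE natr1 ler_nat.
      rewrite (x_alpha j.+1); first by rewrite -natr1; field; exact: lt0r_neq0.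
        by rewrite ltnS lt0n j0.
      by rewrite in_itv/= -natr1 addrK ler_pdivrMr// ltr_pdivlMr// jx.
    have jE : j%:R = n%:R - 1 :> R.
      by rewrite -predE; congr _%:R; apply/eqP; rewrite eqn_leq jn.
    have -> : (x < 1 - a) = false.
      by apply/negbTE; rewrite -leNgt -(ler_pM2r n0) mulrBl an mul1r -jE.
    by rewrite jE divff ?subrr// lt0r_neq0.
  (* The values of [alpha1] are used at both [x] and [x + a]; as [a * n = 1], these lie in the
     intervals of index [j] and [j + 1]. *)
  have := ae_translation a all_ae.
  apply: filterS2 all_ae => x allx allxa x01.
  have xn0 : 0 <= x * n%:R by rewrite mulr_ge0//; lra.
  pose j := Num.truncn (x * n%:R).
  have := truncn_itv xn0; rewrite -/j -natr1 => jx.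
  rewrite -/beta (betaE x j)//; last lra.
  rewrite (betaE (x + a) j.+1)//; last 2 first.
  + by lra.
  + by rewrite -natr1 mulrDl an; lra.
  by rewrite -natr1 aE; field; rewrite !lt0r_neq0.
Qed.
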